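(* Let $d,d'\ge 1$, let $\mathrm{dom}\,X=\{s\in\mathbb{R}^{d+1}:s^0>0\}$ and $\mathrm{dom}\,X'=\{s\in\mathbb{R}^{d'+1}:s^0>0\}$, and let $f=(f^0,\dots,f^{d'}):\mathrm{dom}\,X\to\mathrm{dom}\,X'$. (i) Assume that $f$ satisfies the scaling condition and that the map $F:\mathbb{R}^d\to\mathbb{R}^{d'}$ induced by $f$ is strict inversely convexity preserving and its image $\mathrm{Im}\,F$ is not contained in a straight line. Then $$f(s)=\frac{f^0(s)}{L^0(s)}\,L(s)\qquad\text{for all } s\in\mathrm{dom}\,X,$$ where $f^0$ satisfies the scaling condition, $L=(L^0,\dots,L^{d'}):\mathbb{R}^{d+1}\to\mathbb{R}^{d'+1}$ is a linear map, and $f^0>0$ and $L^0>0$ on $\{s^0>0\}$. (ii) Conversely, if $f(s)=\frac{f^0(s)}{L^0(s)}L(s)$ on $\mathrm{dom}\,X$, where $f^0$ satisfies the scaling condition, $L=(L^0,\dots,L^{d'}):\mathbb{R}^{d+1}\to\mathbb{R}^{d'+1}$ is linear, and $f^0,L^0>0$ on $\{s^0>0\}$, then $f$ induces a map $F:\mathbb{R}^d\to\mathbb{R}^{d'}$ which is strict inversely convexity preserving.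
   Context: Coordinates of $s\in\mathbb{R}^{d+1}$ are written $s=(s^0,s^1,\dots,s^d)$. The perspective function $X:\{s\in\mathbb{R}^{d+1}:s^0>0\}\to\mathbb{R}^d$ is $X(s)=(s^1/s^0,\dots,s^d/s^0)$; $X'$ is the analogous function $\{s\in\mathbb{R}^{d'+1}:s^0>0\}\to\mathbb{R}^{d'}$. Scaling condition for a map $g$ defined on $\mathrm{dom}\,X$ (with values in a Euclidean space): for every $s\in\mathrm{dom}\,X$ and $\lambda>0$ there is $\mu_{\lambda,s}>0$ with $g(\lambda s)=\mu_{\lambda,s}\,g(s)$. If $f:\mathrm{dom}\,X\to\mathrm{dom}\,X'$ satisfies the scaling condition, the map induced by $f$ is the unique (well-defined) $F:\mathbb{R}^d\to\mathbb{R}^{d'}$ with $F(X(s))=X'(f(s))$ for all $s\in\mathrm{dom}\,X$. For $x,y$ in a real vector space, $(x,y)=\{tx+(1-t)y:0<t<1\}$. A map $g:C\to\mathbb{R}^{d'}$ on a convex set $C\subseteq\mathbb{R}^d$ is strict inversely convexity preserving if $g((x,y))\subseteq(g(x),g(y))$ for all $x,y\in C$. *)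

(* Defs.v *)
From HB Require Import structures.
From mathcomp Require Import all_boot all_order all_algebra.
From mathcomp Require Import all_classical all_reals.

Set Implicit Arguments.
Unset Strict Implicit.
Unset Printing Implicit Defensive.

Import Order.TTheory GRing.Theory Num.Theory.

Local Open Scope classical_set_scope.
Local Open Scope ring_scope.

(* Points of R^n are row vectors. A map dom X -> dom X' is a total function
   sending [domX] into [domX]; the definitions below never look at its values,
   or at those of [persp], outside [domX]. *)

Definition rv_coord (R : realType) (n : nat) (s : 'rV[R]_n) (i : 'I_n) : R :=
  s ord0 i.

Definition domX (R : realType) (d : nat) : set 'rV[R]_d.+1 :=
  [set s | 0 < rv_coord s ord0].
Arguments domX {R d}.

Definition persp (R : realType) (d : nat) (s : 'rV[R]_d.+1) : 'rV[R]_d :=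
  \row_(i < d) (rv_coord s (lift ord0 i) / rv_coord s ord0).

(* Real-valued [g] are covered by V := R^o. *)
Definition scaling_condition (R : realType) (d : nat) (V : lmodType R)
    (g : 'rV[R]_d.+1 -> V) : Prop :=
  forall (s : 'rV[R]_d.+1) (lambda : R), domX s -> 0 < lambda ->
    exists2 mu : R, 0 < mu & g (lambda *: s) = mu *: g s.

(* If f satisfies the scaling condition, exactly one F satisfies this: persp
   maps domX onto R^d, with the open rays from the origin as fibres. *)
Definition induces (R : realType) (d d' : nat)
    (f : 'rV[R]_d.+1 -> 'rV[R]_d'.+1) (F : 'rV[R]_d -> 'rV[R]_d') : Prop :=
  forall s : 'rV[R]_d.+1, domX s -> F (persp s) = persp (f s).

(* Equal to [set x] when x = y. *)
Definition open_segment (R : realType) (V : lmodType R) (x y : V) : set V :=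
  [set t *: x + (1 - t) *: y | t in [set t : R | 0 < t < 1]].

(* C is meant to be convex. *)
Definition strict_inv_convexity_preserving (R : realType) (V W : lmodType R)
    (C : set V) (g : V -> W) : Prop :=
  forall x y : V, C x -> C y ->
    g @` open_segment x y `<=` open_segment (g x) (g y).

Definition is_line (R : realType) (V : lmodType R) (A : set V) : Prop :=
  exists a v : V, v != 0 /\ A = [set a + t *: v | t in [set: R]].

(* Main.v *)
(* A map F sending open segments into open segments whose image is not
   contained in a line is affine. If the images of o, a, b are not collinear,
   the images of the midpoints of the sides divide the sides of
   the image triangle in ratios whose product is 1 (Ceva, for the medians), so
   these ratios are quotients of weights w(o) = 1, w(a), w(b), as if F were
   projective with denominator w. The midline shows that w((a + b) / 2) is the
   mean of w(a) and w(b), so w is affine along the progression a + n (b - a);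
   being positive for all integers n it is constant, and F preserves midpoints.
   Monotonicity along segments then gives real homogeneity. *)

Require Import Defs.
From HB Require Import structures.
From mathcomp Require Import all_boot all_order all_algebra.
From mathcomp Require Import all_classical all_reals.
From mathcomp Require Import ring lra.

Set Implicit Arguments.
Unset Strict Implicit.
Unset Printing Implicit Defensive.

Import Order.TTheory GRing.Theory Num.Theory.

Local Open Scope classical_set_scope.
Local Open Scope ring_scope.

(** * Independent pairs of vectors *)

Definition independent (R : realType) (W : lmodType R) (A B : W) : Prop :=
  forall x y : R, x *: A + y *: B = 0 -> x = 0 /\ y = 0.

Lemma independent_sym (R : realType) (W : lmodType R) (A B : W) :
  independent A B -> independent B A.
Proof. by move=> AB x y; rewrite addrC => /AB[]. Qed.

Lemma independent_coef (R : realType) (W : lmodType R) (A B : W) x y x' y' :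
  independent A B -> x *: A + y *: B = x' *: A + y' *: B :> W ->
  x = x' :> R /\ y = y' :> R.
Proof.
move=> AB /eqP; rewrite -subr_eq0 opprD addrACA -!scalerBl => /eqP/AB[].
by move=> /eqP; rewrite subr_eq0 => /eqP-> /eqP; rewrite subr_eq0 => /eqP->.
Qed.

Lemma independent_neq0 (R : realType) (W : lmodType R) (A B : W) :
  independent A B -> A != 0.
Proof.
move=> AB; apply/eqP => A0.
have [] := AB 1 0; first by rewrite A0 scaler0 scale0r addr0.
by move=> /eqP; rewrite oner_eq0.
Qed.

(** An exchange step: it carries independence from the images of [a] and [b] to those of a further
    point on the line through them. *)
Lemma independent_combination (R : realType) (W : lmodType R) (A B C : W)
    (p q r : R) :
  independent A B -> r *: C = p *: A + q *: B -> p != 0 -> r != 0 ->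
  independent B C.
Proof.
move=> AB CE p0 r0 x y xyE.
have : (y * p) *: A + (r * x + y * q) *: B = 0.
  rewrite -[RHS](scaler0 _ r) -xyE scalerDr !scalerA [r * y]mulrC.
  by rewrite -[(y * r) *: C]scalerA CE scalerDr !scalerA scalerDl addrCA.
move=> /AB[/eqP]; rewrite mulf_eq0 (negPf p0) orbF => /eqP->.
by move=> /eqP; rewrite mul0r addr0 mulf_eq0 (negPf r0) => /eqP->.
Qed.

Lemma strict_inv_convexity_segment (R : realType) (V W : lmodType R)
    (G : V -> W) (t : R) (x y : V) :
  strict_inv_convexity_preserving [set: V] G -> 0 < t < 1 ->
  exists2 u : R, 0 < u < 1 &
    G (t *: x + (1 - t) *: y) = u *: G x + (1 - u) *: G y.
Proof.
move=> sG t01; have [] := sG x y I I (G (t *: x + (1 - t) *: y)).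
  by exists (t *: x + (1 - t) *: y) => //; exists t.
by move=> u u01 uE; exists u.
Qed.

(* If G = N / w with N and w affine, N 0 = 0 and w 0 = 1, the midpoint of 0 and
   x is sent to w(x) G(x) / (1 + w(x)); this reads w(x) off G. *)
Definition midpoint_weight (R : realType) (V W : lmodType R) (G : V -> W)
    (x : V) (w : R) : Prop :=
  0 < w /\ (1 + w) *: G (2^-1 *: x) = w *: G x.

(** * Weights read off from midpoints *)

Section Midpoint.
Variables (R : realType) (V W : lmodType R) (G : V -> W).
Hypothesis sG : strict_inv_convexity_preserving [set: V] G.
Hypothesis G0 : G 0 = 0.

Lemma midpoint_weight_exists (x : V) : exists w, midpoint_weight G x w.
Proof.
have h01 : 0 < (2^-1 : R) < 1 by lra.
have [u u01] := strict_inv_convexity_segment x 0 sG h01.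
(* The witness solves [(1 + w) * u = w]. *)
rewrite G0 !scaler0 !addr0 => xE; exists (u / (1 - u)); split.
  by rewrite divr_gt0 //; lra.
by rewrite xE scalerA; congr (_ *: _); field; lra.
Qed.

Lemma midpoint_weight_unique (x : V) (w w' : R) :
  G x != 0 -> midpoint_weight G x w -> midpoint_weight G x w' -> w = w'.
Proof.
move=> Gx0 [w0 wE] [w'0 w'E].
have e : (1 + w') *: (w *: G x) = (1 + w) *: (w' *: G x).
  by rewrite -wE -w'E !scalerA mulrC.
move/eqP: e; rewrite !scalerA -subr_eq0 -scalerBl scaler_eq0 (negPf Gx0) orbF.
by move/eqP; lra.
Qed.

(* Ceva for the three medians of the triangle 0, a, b, then the crossing of the
   median from 0 with the midline of a/2 and b/2. *)
Lemma midpoint_weight_mid (a b : V) (wa wb : R) :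
  independent (G a) (G b) -> midpoint_weight G a wa -> midpoint_weight G b wb ->
  (wa + wb) *: G (2^-1 *: (a + b)) = wa *: G a + wb *: G b /\
  midpoint_weight G (2^-1 *: (a + b)) (2^-1 * (wa + wb)).
Proof.
move=> ab [wa0 waE] [wb0 wbE].
have half : 0 < (2^-1 : R) < 1 by lra.
have third : 0 < (3^-1 : R) < 1 by lra.
have twothird : 0 < (2 / 3 : R) < 1 by lra.
have {}waE : G (2^-1 *: a) = (wa / (1 + wa)) *: G a.
  apply: (@scalerI _ _ (1 + wa)); first by lra.
  by rewrite waE scalerA; congr (_ *: _); field; lra.
have {}wbE : G (2^-1 *: b) = (wb / (1 + wb)) *: G b.
  apply: (@scalerI _ _ (1 + wb)); first by lra.
  by rewrite wbE scalerA; congr (_ *: _); field; lra.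
have [u u01] := strict_inv_convexity_segment a b sG half.
have -> : 2^-1 *: a + (1 - 2^-1) *: b = 2^-1 *: (a + b).
  by rewrite scalerDr; congr (_ + _ *: _); lra.
move=> mE.
(* The centroid of 0, [a], [b] is placed on each of the three medians, and coefficients of [G a] and
   [G b] are compared. *)
have [k k01] := strict_inv_convexity_segment (2^-1 *: (a + b)) 0 sG twothird.
have -> : (2 / 3) *: (2^-1 *: (a + b)) + (1 - 2 / 3) *: 0 = 3^-1 *: (a + b).
  by rewrite scaler0 addr0 scalerA; congr (_ *: _); lra.
rewrite G0 scaler0 addr0 mE => gE.
have [l l01] := strict_inv_convexity_segment a (2^-1 *: b) sG third.
have -> : 3^-1 *: a + (1 - 3^-1) *: (2^-1 *: b) = 3^-1 *: (a + b).
  by rewrite scalerA scalerDr; congr (_ + _ *: _); lra.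
rewrite gE wbE scalerDr !scalerA => /(independent_coef ab)[la lb].
have [l' l'01] := strict_inv_convexity_segment b (2^-1 *: a) sG third.
have -> : 3^-1 *: b + (1 - 3^-1) *: (2^-1 *: a) = 3^-1 *: (a + b).
  by rewrite scalerA addrC scalerDr; congr (_ *: _ + _); lra.
rewrite gE waE scalerDr !scalerA [RHS]addrC.
move=> /(independent_coef ab)[l'a l'b].
(* A quarter of [a + b] is the midpoint both of 0 and the midpoint of [a], [b], and of the halves of
   [a] and [b]. *)
have [r r01] := strict_inv_convexity_segment (2^-1 *: (a + b)) 0 sG half.
rewrite G0 !scaler0 !addr0 mE => rE.
have [j j01] := strict_inv_convexity_segment (2^-1 *: a) (2^-1 *: b) sG half.
have -> : 2^-1 *: (2^-1 *: a) + (1 - 2^-1) *: (2^-1 *: b)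
          = 2^-1 *: (2^-1 *: (a + b)).
  by rewrite !scalerDr; congr (_ + _ *: _); lra.
rewrite rE waE wbE scalerDr !scalerA => /(independent_coef ab)[ja jb].
(* Eliminating [l] and [l'] leaves two linear equations in [k * u] and [k * (1 - u)]. Scaled to the
   common right side [wa * wb] they can be subtracted, and [k], being positive, cancels. *)
have uE : (wa + wb) * u = wa.
  have e1 : (1 + wb) * (k * (1 - u)) = (1 - l) * wb by rewrite lb; field; lra.
  have e2 : (1 + wa) * (k * u) = (1 - l') * wa by rewrite l'a; field; lra.
  have e3 : k * (wa * (1 - u) - wb * u) = 0.
    have : (1 + wb) * (k * (1 - u)) + wb * (k * u) = wb by rewrite e1 la; ring.
    have : (1 + wa) * (k * u) + wa * (k * (1 - u)) = wa by rewrite e2 l'b; ring.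
    move=> f1 f2.
    have : wb * ((1 + wa) * (k * u) + wa * (k * (1 - u))) =
           wa * ((1 + wb) * (k * (1 - u)) + wb * (k * u)) by rewrite f1 f2; ring.
    by lra.
  by move/eqP: e3; rewrite mulf_eq0 => /orP[/eqP|/eqP]; lra.
have u'E : (wa + wb) * (1 - u) = wb by lra.
split; first by rewrite scalerDr !scalerA uE u'E.
split; first by lra.
have e1 : (1 + wa) * (r * u) = j * wa by rewrite ja; field; lra.
have e2 : (1 + wb) * (r * (1 - u)) = (1 - j) * wb by rewrite jb; field; lra.
suff rr : (1 + 2^-1 * (wa + wb)) * r = 2^-1 * (wa + wb)
  by rewrite rE mE scalerA rr.
have f1 : (1 + wa) * (r * wa) = (wa + wb) * (j * wa).
  by rewrite -e1 -[in r * wa]uE; ring.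
have f2 : (1 + wb) * (r * wb) = (wa + wb) * ((1 - j) * wb).
  by rewrite -e2 -[in r * wb]u'E; ring.
(* The sum of the next two relations is free of [j] and is twice the goal. *)
have {}f1 : (1 + wa) * r = (wa + wb) * j.
  by apply: (@mulfI _ wa); lra.
have {}f2 : (1 + wb) * r = (wa + wb) * (1 - j).
  by apply: (@mulfI _ wb); lra.
lra.
Qed.

(* The weight is affine and positive along the line through a and b, hence
   constant on it; the points used here are a + n (b - a). *)
Lemma midpoint_weight_progression_gt0 (n : nat) (a b : V) (wa wb : R) :
  independent (G a) (G b) -> midpoint_weight G a wa -> midpoint_weight G b wb ->
  0 < wa + n%:R * (wb - wa).
Proof.
elim: n a b wa wb => [|n IH] a b wa wb ab Ha Hb.
  by rewrite mul0r addr0; case: Ha.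
have h01 : 0 < (2^-1 : R) < 1 by lra.
(* The next point of the progression: [b] is the midpoint of [a] and [c], and the induction moves on
   to the pair [b], [c]. *)
pose c := 2 *: b - a.
have [t t01] := strict_inv_convexity_segment a c sG h01.
have -> : 2^-1 *: a + (1 - 2^-1) *: c = b.
  have -> : 1 - 2^-1 = 2^-1 :> R by lra.
  by rewrite -scalerDr addrC subrK scalerA mulVf ?scale1r //; lra.
move=> bE; have cE : (1 - t) *: G c = - t *: G a + 1 *: G b.
  by rewrite scale1r [G b]bE scaleNr addKr.
have t'0 : 1 - t != 0 by lra.
have bc : independent (G b) (G c).
  by apply: (independent_combination _ cE) => //; lra.
have ac : independent (G a) (G c).
  move: cE; rewrite [_ + 1 *: _]addrC => cE.
  apply: (independent_combination _ cE) => //; first exact: independent_sym.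
  exact: oner_neq0.
have [wc Hc] := midpoint_weight_exists c.
(* The mean of [wa] and [wc] is a weight of [b], so by uniqueness it is [wb]; the weights continue
   with the same difference. *)
have [_] := midpoint_weight_mid ac Ha Hc.
rewrite addrC subrK scalerA mulVf ?scale1r; last by lra.
move=> /(midpoint_weight_unique (independent_neq0 bc) Hb) wE.
have := IH _ _ _ _ bc Hb Hc.
have -> : wc = 2 * wb - wa by lra.
by rewrite -natr1; lra.
Qed.

(** If [wb < wa], the weights along the progression would become negative. Used in both orders, this
    makes the two weights equal. *)
Lemma midpoint_weight_le (a b : V) (wa wb : R) :
  independent (G a) (G b) -> midpoint_weight G a wa -> midpoint_weight G b wb ->
  wa <= wb.
Proof.
move=> ab Ha Hb; rewrite leNgt; apply/negP => lt_wb.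
have [n] : exists n : nat, wa / (wa - wb) < n%:R.
  by exists (Num.bound (wa / (wa - wb))); apply/archi_boundP/divr_ge0;
    case: Ha; lra.
rewrite ltr_pdivrMr ?subr_gt0 // => ltn.
by have := midpoint_weight_progression_gt0 n ab Ha Hb; lra.
Qed.

Lemma midpoint_of_independent (a b : V) :
  independent (G a) (G b) ->
  G (2^-1 *: (a + b)) = 2^-1 *: (G a + G b).
Proof.
move=> ab; have [wa Ha] := midpoint_weight_exists a.
have [wb Hb] := midpoint_weight_exists b.
have wE : wa = wb.
  apply/le_anti; rewrite (midpoint_weight_le ab Ha Hb).
  exact: midpoint_weight_le (independent_sym ab) Hb Ha.
rewrite -wE in Hb; have [] := midpoint_weight_mid ab Ha Hb.
have [wa0 _] := Ha; rewrite -scalerDr => mE _.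
apply: (@scalerI _ _ (wa + wa)); first by lra.
by rewrite mE scalerA; congr (_ *: _); lra.
Qed.

End Midpoint.

(** * Preservation of all midpoints *)

Section Affine.
Variables (R : realType) (V W : lmodType R) (F : V -> W).
Hypothesis sF : strict_inv_convexity_preserving [set: V] F.

(** Any point can thus serve as the origin with value 0 that the weights require. *)
Lemma strict_inv_convexity_translate (o : V) :
  strict_inv_convexity_preserving [set: V] (fun x => F (o + x) - F o).
Proof.
move=> x y _ _ _ [_ [t t01 <-] <-].
have [u u01 uE] := strict_inv_convexity_segment (o + x) (o + y) sF t01.
exists u => //; rewrite !scalerBr addrACA -uE -opprD -scalerDl.
congr (F _ - _).
  by rewrite !scalerDr addrACA -scalerDl [t + _]addrC subrK scale1r.
by rewrite [u + _]addrC subrK scale1r.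
Qed.

Hypothesis nF : ~ (exists A : set W, is_line A /\ range F `<=` A).

Lemma strict_inv_convexity_midpoint (a b : V) :
  F (2^-1 *: (a + b)) = 2^-1 *: (F a + F b).
Proof.
have h01 : 0 < (2^-1 : R) < 1 by lra.
(* When the end points have the same image, the target segment is a single point. *)
have [Fab|Fab] := eqVneq (F a) (F b).
  have [u u01] := strict_inv_convexity_segment a b sF h01.
  have -> : 1 - 2^-1 = 2^-1 :> R by lra.
  rewrite -scalerDr => ->; rewrite Fab -scalerDl addrC subrK scale1r.
  by rewrite -[F b + F b]mulr2n -scaler_nat scalerA mulVf ?scale1r //; lra.
(* The image is not contained in the line through [F a] and [F b], so some [F o] lies off it; with
   [o] as origin the images of [a] and [b] become independent. *)
have [o Fo] : exists o, forall t : R, F o <> F a + t *: (F b - F a).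
  apply: contra_notP nF => No.
  exists [set F a + t *: (F b - F a) | t in [set: R]]; split.
    by exists (F a), (F b - F a); rewrite subr_eq0 eq_sym.
  move=> _ [o _ <-]; apply: contra_notP No => /= No.
  by exists o => t tE; apply: No; exists t.
pose G x := F (o + x) - F o.
have G0 : G 0 = 0 by rewrite /G addr0 subrr.
have FG x : F x = G (x - o) + F o by rewrite /G subrK [o + _]addrC subrK.
have iG : independent (G (a - o)) (G (b - o)).
  rewrite /G ![o + _]addrC !subrK => x y /eqP.
  rewrite !scalerBr addrACA -opprD -scalerDl subr_eq0 => /eqP xyE.
  (* If [x + y] is zero, the relation is a multiple of [F b - F a]; otherwise it puts [F o] on the
     line, at parameter [y / (x + y)]. *)
  have [xy|xy] := eqVneq (x + y) 0.
    move: xyE; rewrite xy scale0r; have -> : x = - y by lra.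
    rewrite scaleNr addrC -scalerBr => /eqP.
    rewrite scaler_eq0 subr_eq0 [F b == _]eq_sym (negPf Fab) orbF => /eqP->.
    by rewrite oppr0.
  case: (Fo (y / (x + y))); apply: (@scalerI _ _ (x + y)) => //.
  rewrite -xyE scalerDr scalerA mulrCA mulfV // mulr1 scalerBr scalerDl.
  by rewrite -addrA [y *: F a + _]addrC subrK.
have mE : G (2^-1 *: (a - o + (b - o))) = 2^-1 *: (G (a - o) + G (b - o)).
  exact: midpoint_of_independent (@strict_inv_convexity_translate o) G0 _ _ iG.
move: mE; have -> : 2^-1 *: (a - o + (b - o)) = 2^-1 *: (a + b) - o.
  rewrite addrACA -opprD scalerBr -[o + o]mulr2n -scaler_nat scalerA.
  by rewrite mulVf ?scale1r //; lra.
move: G {iG G0} FG => G FG mE.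
rewrite [LHS]FG mE [F a]FG [F b]FG addrACA [RHS]scalerDr.
congr (_ + _); rewrite -[F o + F o]mulr2n -scaler_nat scalerA.
by rewrite mulVf ?scale1r //; lra.
Qed.

End Affine.

(** * From midpoints to linearity *)

Section Linear.
Variables (R : realType) (V W : lmodType R) (G : V -> W).
Hypothesis sG : strict_inv_convexity_preserving [set: V] G.
Hypothesis G0 : G 0 = 0.
Hypothesis mG : forall a b : V, G (2^-1 *: (a + b)) = 2^-1 *: (G a + G b).

(** The midpoint of [a + b] and 0 is also that of [a] and [b]. *)
Lemma midpoint_preservingD (a b : V) : G (a + b) = G a + G b.
Proof.
have half0 : (2^-1 : R) != 0 by rewrite invr_eq0 pnatr_eq0.
have := mG (a + b) 0; rewrite G0 !addr0 mG => e.
by apply: (scalerI half0).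
Qed.

Lemma midpoint_preservingN (a : V) : G (- a) = - G a.
Proof.
by apply/eqP; rewrite -addr_eq0 -midpoint_preservingD addNr G0.
Qed.

Lemma midpoint_preservingMn (n : nat) (a : V) : G (n%:R *: a) = n%:R *: G a.
Proof.
elim: n => [|n IH]; first by rewrite !scale0r.
by rewrite -natr1 !scalerDl !scale1r midpoint_preservingD IH.
Qed.

(* With k the integer part of n t, the remainder (n t - k) a lies between 0
   and a. *)
Lemma midpoint_preservingZ_approx (n : nat) (t : R) (a : V) : 0 <= t ->
  exists2 r : R, `|r - n%:R * t| <= 1 & n%:R *: G (t *: a) = r *: G a.
Proof.
move=> t0; have nt0 : 0 <= n%:R * t by rewrite mulr_ge0.
pose k := Num.truncn (n%:R * t); have /andP[kle klt] := truncn_itv nt0.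
rewrite -natr1 -/k in kle klt.
have [u u01 uE] : exists2 u : R, 0 <= u <= 1 &
    G ((n%:R * t - k%:R) *: a) = u *: G a.
  (* A zero remainder is not covered by the open segment. *)
  have [e|ne] := eqVneq (n%:R * t - k%:R) 0.
    by exists 0; [lra | rewrite e !scale0r].
  have e01 : 0 < n%:R * t - k%:R < 1.
    by rewrite lt_def ne subr_ge0 kle /=; lra.
  have [u u01] := strict_inv_convexity_segment a 0 sG e01.
  by rewrite G0 !scaler0 !addr0 => uE; exists u => //; lra.
(* Both [k%:R + u] and [n%:R * t] lie between [k] and [k + 1]. *)
exists (k%:R + u); first by rewrite ler_norml; lra.
rewrite -midpoint_preservingMn scalerA scalerDl -uE -midpoint_preservingMn.
by rewrite -midpoint_preservingD -scalerDl addrC subrK.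
Qed.

(** The approximation with [n = 1] makes [G (t *: a)] a multiple [s *: G a]. If [G a] is nonzero,
    larger [n] give [n |s - t| <= 1], so [s = t] because the reals are archimedean. *)
Lemma midpoint_preservingZ_ge0 (t : R) (a : V) : 0 <= t ->
  G (t *: a) = t *: G a.
Proof.
move=> t0; have [s _] := midpoint_preservingZ_approx 1 a t0.
rewrite scale1r => sE; have [Ga|Ga] := eqVneq (G a) 0.
  by rewrite sE Ga !scaler0.
suff st : `|s - t| <= 0 by rewrite sE; congr (_ *: _); move: st;
  rewrite normr_le0 subr_eq0 => /eqP.
rewrite leNgt; apply/negP => st0.
have [n ltn] : exists n : nat, `|s - t|^-1 < n%:R.
  by exists (Num.bound (`|s - t|^-1)); apply/archi_boundP; rewrite invr_ge0.
have [r rt] := midpoint_preservingZ_approx n a t0.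
rewrite sE scalerA => /eqP; rewrite -subr_eq0 -scalerBl scaler_eq0.
rewrite (negPf Ga) orbF subr_eq0 => /eqP rE; move: rt.
rewrite -rE -mulrBr normrM normr_nat => rt.
by move: ltn; rewrite -(ltr_pM2r st0) mulVf ?gt_eqF // ltNge rt.
Qed.

Lemma midpoint_preserving_linear : linear G.
Proof.
move=> t a b; rewrite midpoint_preservingD; congr (_ + _).
have [t0|t0] := leP 0 t; first exact: midpoint_preservingZ_ge0.
apply: oppr_inj; rewrite -midpoint_preservingN -!scaleNr.
by apply: midpoint_preservingZ_ge0; lra.
Qed.

End Linear.

Lemma strict_inv_convexity_linear (R : realType) (V W : lmodType R)
    (F : V -> W) :
  strict_inv_convexity_preserving [set: V] F ->
  ~ (exists A : set W, is_line A /\ range F `<=` A) ->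
  linear (fun x => F x - F 0).
Proof.
move=> sF nF; apply: midpoint_preserving_linear.
- have := @strict_inv_convexity_translate _ _ _ _ sF 0.
  by under eq_fun do rewrite add0r.
- exact: subrr.
- move=> a b; rewrite (strict_inv_convexity_midpoint sF nF) addrACA -opprD.
  rewrite [RHS]scalerBr -[F 0 + F 0]mulr2n -scaler_nat scalerA.
  by rewrite mulVf ?scale1r ?pnatr_eq0.
Qed.

(** * Homogeneous coordinates *)

Lemma domX_scale (R : realType) (d : nat) (s : 'rV[R]_d.+1) (c : R) :
  0 < c -> domX s -> domX (c *: s).
Proof. by move=> c0 s0; rewrite /domX /= /rv_coord mxE mulr_gt0. Qed.

Lemma perspZ (R : realType) (d : nat) (s : 'rV[R]_d.+1) (c : R) :
  c != 0 -> persp (c *: s) = persp s.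
Proof.
by move=> c0; apply/rowP => i; rewrite !mxE /rv_coord !mxE -mulf_div mulfV ?mul1r.
Qed.

(** The section of [persp] over the hyperplane of zeroth coordinate 1; [unlift] returns [None]
    exactly at index 0. *)
Definition homogenize (R : realType) (d : nat) (x : 'rV[R]_d) : 'rV[R]_d.+1 :=
  \row_i oapp (x ord0) 1 (unlift ord0 i).

Lemma homogenize0 (R : realType) (d : nat) (x : 'rV[R]_d) :
  rv_coord (homogenize x) ord0 = 1.
Proof. by rewrite /rv_coord mxE unlift_none. Qed.

Lemma homogenizeS (R : realType) (d : nat) (x : 'rV[R]_d) (i : 'I_d) :
  rv_coord (homogenize x) (lift ord0 i) = x ord0 i.
Proof. by rewrite /rv_coord mxE liftK. Qed.

Lemma domX_homogenize (R : realType) (d : nat) (x : 'rV[R]_d) :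
  domX (homogenize x).
Proof. by rewrite /domX /= homogenize0. Qed.

Lemma homogenizeK (R : realType) (d : nat) :
  cancel (@homogenize R d) (@persp R d).
Proof.
by move=> x; apply/rowP => i; rewrite mxE homogenize0 homogenizeS divr1.
Qed.

Lemma homogenize_persp (R : realType) (d : nat) (s : 'rV[R]_d.+1) :
  domX s -> s = rv_coord s ord0 *: homogenize (persp s).
Proof.
move=> s0; apply/rowP => i; rewrite mxE.
have [j ->|->] := unliftP ord0 i.
  rewrite -/(rv_coord (homogenize _) _) homogenizeS mxE mulrC divfK //.
  exact: lt0r_neq0.
by rewrite -/(rv_coord (homogenize _) _) homogenize0 mulr1.
Qed.

Lemma homogenize_conv (R : realType) (d : nat) (x y : 'rV[R]_d) (t : R) :
  homogenize (t *: x + (1 - t) *: y) =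
  t *: homogenize x + (1 - t) *: homogenize y.
Proof.
apply/rowP => i; rewrite !mxE.
by case: (unlift _ _) => [j|] /=; rewrite ?mxE; lra.
Qed.

(** The usual linearization of an affine map: a vector with zeroth coordinate c and tail v goes to
    the one with zeroth coordinate c and tail [c *: F 0 + T v]. On [domX] the tail v is c times the
    perspective. *)
Lemma homogenized_affine (R : realType) (d d' : nat)
    (F : 'rV[R]_d -> 'rV[R]_d') :
  linear (fun x => F x - F 0) ->
  exists L : {linear 'rV[R]_d.+1 -> 'rV[R]_d'.+1},
    forall s, domX s -> L s = rv_coord s ord0 *: homogenize (F (persp s)).
Proof.
move=> linF.
pose T : {linear 'rV[R]_d -> 'rV[R]_d'} := HB.pack (fun x => F x - F 0)
  (GRing.isLinear.Build R 'rV[R]_d 'rV[R]_d' *:%R (fun x => F x - F 0) linF).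
pose tl (s : 'rV[R]_d.+1) : 'rV[R]_d := \row_i rv_coord s (lift ord0 i).
pose L (s : 'rV[R]_d.+1) : 'rV[R]_d'.+1 :=
  \row_i oapp (fun j => (rv_coord s ord0 *: F 0 + T (tl s)) ord0 j)
    (rv_coord s ord0) (unlift ord0 i).
have linL : linear L.
  move=> a s s'; have tlE : tl (a *: s + s') = a *: tl s + tl s'.
    by apply/rowP => i; rewrite !mxE /rv_coord !mxE.
  apply/rowP => i; rewrite !mxE /rv_coord tlE linearP !mxE.
  case: (unlift _ _) => [j|] //=; rewrite !mxE; lra.
pose linearL : {linear 'rV[R]_d.+1 -> 'rV[R]_d'.+1} := HB.pack L
  (GRing.isLinear.Build R 'rV[R]_d.+1 'rV[R]_d'.+1 *:%R L linL).
exists linearL => s s0 /=.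
have tlE : tl s = rv_coord s ord0 *: persp s.
  apply/rowP => i; rewrite !mxE mulrC divfK //.
  exact: lt0r_neq0.
apply/rowP => i; rewrite !mxE tlE linearZ /=.
case: (unlift _ _) => [j|] /=; last by rewrite mulr1.
by rewrite !mxE; lra.
Qed.

(** * Maps of the form required by the theorem *)

(** The factor of the zeroth coordinate of [f] also serves for [f]: in the quotient of [L] by its
    zeroth coordinate, [l] cancels. *)
Lemma linear_perspective_scaling (R : realType) (d d' : nat)
    (f : 'rV[R]_d.+1 -> 'rV[R]_d'.+1)
    (L : {linear 'rV[R]_d.+1 -> 'rV[R]_d'.+1}) :
  scaling_condition (fun s => rv_coord (f s) ord0 : R^o) ->
  (forall s, domX s -> 0 < rv_coord (L s) ord0) ->
  (forall s, domX s ->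
     f s = (rv_coord (f s) ord0 / rv_coord (L s) ord0) *: L s) ->
  scaling_condition f.
Proof.
move=> scf Lpos fE s l s0 l0; have [m m0 mE] := scf s l s0 l0.
exists m => //; rewrite fE; last exact: domX_scale.
rewrite mE [in RHS]fE // linearZ /= !scalerA; congr (_ *: _).
rewrite {2}/rv_coord mxE -/(rv_coord _ _).
have L0 := lt0r_neq0 (Lpos s s0); rewrite /GRing.scale /=.
by field; rewrite L0 gt_eqF.
Qed.

Lemma linear_perspective_segment (R : realType) (d d' : nat)
    (L : {linear 'rV[R]_d.+1 -> 'rV[R]_d'.+1}) :
  (forall s, domX s -> 0 < rv_coord (L s) ord0) ->
  strict_inv_convexity_preserving [set: 'rV[R]_d]
    (fun x => persp (L (homogenize x))).
Proof.
move=> Lpos x y _ _ _ [_ [t /= t01 <-] <-]; rewrite homogenize_conv.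
rewrite linearP linearZ /=.
move: (Lpos _ (domX_homogenize x)) (Lpos _ (domX_homogenize y)).
move: (L _) (L _) => v u u0 v0.
set w := t * rv_coord u ord0 + (1 - t) * rv_coord v ord0.
have t'0 : 0 < 1 - t by lra.
have t0 : 0 < t by lra.
have tu := mulr_gt0 t0 u0; have tv := mulr_gt0 t'0 v0.
have w0 : 0 < w by rewrite /w; lra.
(* The weights [t] and [1 - t] are multiplied by the denominators of the two end points, then
   normalized by their sum [w]. *)
exists (t * rv_coord u ord0 / w).
  by rewrite /= divr_gt0 //= ltr_pdivrMr // mul1r /w; lra.
have u0' := lt0r_neq0 u0; have v0' := lt0r_neq0 v0; have w0' := lt0r_neq0 w0.
apply/rowP => i; rewrite !mxE.
have -> : rv_coord (t *: u + (1 - t) *: v) ord0 = w.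
  by rewrite /rv_coord !mxE.
have -> : 1 - t * rv_coord u ord0 / w = (1 - t) * rv_coord v ord0 / w.
  by apply: (mulIf w0'); rewrite mulrBl !divfK // mul1r /w; lra.
have -> : rv_coord (t *: u + (1 - t) *: v) (lift ord0 i) =
    t * rv_coord u (lift ord0 i) + (1 - t) * rv_coord v (lift ord0 i).
  by rewrite /rv_coord !mxE.
by field; rewrite u0' v0' w0'.
Qed.

(** [persp] ignores nonzero factors, both between [f s] and [L s] and between [s] and its
    homogenized perspective. *)
Lemma linear_perspective_induces (R : realType) (d d' : nat)
    (f : 'rV[R]_d.+1 -> 'rV[R]_d'.+1)
    (L : {linear 'rV[R]_d.+1 -> 'rV[R]_d'.+1}) :
  (forall s, domX s -> 0 < rv_coord (f s) ord0 /\ 0 < rv_coord (L s) ord0) ->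
  (forall s, domX s ->
     f s = (rv_coord (f s) ord0 / rv_coord (L s) ord0) *: L s) ->
  induces f (fun x => persp (L (homogenize x))).
Proof.
move=> pos fE s s0; have [f0 L0] := pos s s0.
rewrite (fE _ s0) perspZ ?mulf_neq0 ?invr_eq0 ?lt0r_neq0 //.
by rewrite [in RHS](homogenize_persp s0) linearZ perspZ ?lt0r_neq0.
Qed.

Theorem theorem3 (R : realType) (d d' : nat) (hd : (1 <= d)%N) (hd' : (1 <= d')%N)
    (f : 'rV[R]_d.+1 -> 'rV[R]_d'.+1)
    (hf : forall s : 'rV[R]_d.+1, domX s -> domX (f s)) :
  (forall F : 'rV[R]_d -> 'rV[R]_d',
     scaling_condition f ->
     induces f F ->
     strict_inv_convexity_preserving [set: 'rV[R]_d] F ->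
     ~ (exists A : set 'rV[R]_d', is_line A /\ range F `<=` A) ->
     scaling_condition (fun s => rv_coord (f s) ord0 : R^o) /\
     exists L : {linear 'rV[R]_d.+1 -> 'rV[R]_d'.+1},
       (forall s : 'rV[R]_d.+1, domX s ->
          0 < rv_coord (f s) ord0 /\ 0 < rv_coord (L s) ord0) /\
       (forall s : 'rV[R]_d.+1, domX s ->
          f s = (rv_coord (f s) ord0 / rv_coord (L s) ord0) *: L s))
  /\
  (forall L : {linear 'rV[R]_d.+1 -> 'rV[R]_d'.+1},
     scaling_condition (fun s => rv_coord (f s) ord0 : R^o) ->
     (forall s : 'rV[R]_d.+1, domX s ->
        0 < rv_coord (f s) ord0 /\ 0 < rv_coord (L s) ord0) ->
     (forall s : 'rV[R]_d.+1, domX s ->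
        f s = (rv_coord (f s) ord0 / rv_coord (L s) ord0) *: L s) ->
     scaling_condition f /\
     exists2 F : 'rV[R]_d -> 'rV[R]_d',
       unique (induces f) F &
       strict_inv_convexity_preserving [set: 'rV[R]_d] F).
Proof.
split=> [F scf indF sF nF|L scf pos fE].
  split.
    move=> s l s0 l0; have [m m0 mE] := scf s l s0 l0.
    by exists m; rewrite // mE /rv_coord mxE.
  have [L LE] := homogenized_affine (strict_inv_convexity_linear sF nF).
  (* For this [L] the denominator is the zeroth coordinate of [s], and the formula amounts to
     rebuilding [f s] from its zeroth coordinate and its perspective. *)
  have L0 s : domX s -> rv_coord (L s) ord0 = rv_coord s ord0.
    move=> s0; rewrite LE // {1}/rv_coord mxE -/(rv_coord (homogenize _) _).
    by rewrite homogenize0 mulr1.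
  exists L; split=> s s0; first by rewrite L0 //; split=> //; apply: hf.
  rewrite L0 // LE // scalerA divfK ?lt0r_neq0 // indF //.
  exact/homogenize_persp/hf.
have Lpos s : domX s -> 0 < rv_coord (L s) ord0 by move=> /pos[].
split; first exact: linear_perspective_scaling fE.
exists (fun x => persp (L (homogenize x)));
  last exact: linear_perspective_segment.
have ind := linear_perspective_induces pos fE.
(* Uniqueness: each [x] is the perspective of a point of [domX]. *)
split=> // F' indF'; apply/funext => x.
have := domX_homogenize x; rewrite -[in F' x](homogenizeK x) => xX.
by rewrite indF' // -ind // homogenizeK.
Qed.
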